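(* Let $\mathbb{F}$ be a field of characteristic $2$, let $((\mathfrak{g},[2]),\mathscr{D})$ be a ResLieDer pair over $\mathbb{F}$, and let $(V,\rho,\eta_V)$ be a restricted representation of it. Equip the vector space $\mathfrak{g}\oplus V$ with the Lie bracket $$[x+u,y+v]_\rho=[x,y]_{\mathfrak{g}}+\rho(x)(v)-\rho(y)(u),\qquad x,y\in\mathfrak{g},\ u,v\in V,$$ and define maps $[2]_\rho:\mathfrak{g}\oplus V\to\mathfrak{g}\oplus V$ and $\mathscr{D}+\eta_V:\mathfrak{g}\oplus V\to\mathfrak{g}\oplus V$ by $$(x+u)^{[2]_\rho}=x^{[2]}+\rho(x)(u),\qquad (\mathscr{D}+\eta_V)(x+u)=\mathscr{D}(x)+\eta_V(u),\qquad x\in\mathfrak{g},\ u\in V.$$ Then $((\mathfrak{g}\oplus V,[2]_\rho),\mathscr{D}+\eta_V)$ is a ResLieDer pair.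
   Context: Over a field $\mathbb{F}$ of characteristic $2$: a restricted Lie algebra $(\mathfrak{g},[2])$ is a Lie algebra $\mathfrak{g}$ with a map (a $2$-mapping) $x\mapsto x^{[2]}$ on $\mathfrak{g}$ such that, for all $x,y\in\mathfrak{g}$, $a\in\mathbb{F}$: $[x^{[2]},y]_{\mathfrak{g}}=[x,[x,y]_{\mathfrak{g}}]_{\mathfrak{g}}$, $(ax)^{[2]}=a^2x^{[2]}$, and $(x+y)^{[2]}=x^{[2]}+y^{[2]}+[x,y]_{\mathfrak{g}}$. A restricted derivation of $(\mathfrak{g},[2])$ is a (linear) derivation $\mathscr{D}$ of the Lie algebra $\mathfrak{g}$ with $\mathscr{D}(x^{[2]})=[x,\mathscr{D}(x)]_{\mathfrak{g}}$ for all $x$. A ResLieDer pair $((\mathfrak{g},[2]),\mathscr{D})$ is a restricted Lie algebra together with a restricted derivation. A restricted representation $(V,\rho,\eta_V)$ of it is a vector space $V$, a linear map $\eta_V\in\mathfrak{gl}(V)$, and a Lie algebra morphism $\rho:\mathfrak{g}\to\mathfrak{gl}(V)$ with $\rho(x^{[2]})=\rho(x)^2$ and $\eta_V\circ\rho(x)=\rho(\mathscr{D}(x))+\rho(x)\circ\eta_V$ for all $x\in\mathfrak{g}$. *)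

(* Defs.v *)
From mathcomp Require Import all_boot all_order all_algebra.

Set Implicit Arguments.
Unset Strict Implicit.
Unset Printing Implicit Defensive.

Import GRing.Theory.
Local Open Scope ring_scope.

(* Structures are given as predicates on a bracket, a 2-mapping, etc. on an
   F-vector space of arbitrary dimension; identities between elements of gl(V)
   are stated pointwise. *)

Section LieAlgebras.
Variables (F : fieldType) (g : lmodType F).
Implicit Types (br : g -> g -> g) (sq D : g -> g).

(* [x, x] = 0 is required, not just antisymmetry: the two differ in
   characteristic 2. *)
Record lie_algebra br : Prop := LieAlgebra {
  lie_linearl : forall y, linear (br^~ y);
  lie_linearr : forall x, linear (br x);
  lie_alternating : forall x, br x x = 0;
  lie_jacobi : forall x y z,
    br x (br y z) + br y (br z x) + br z (br x y) = 0
}.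

Record restricted_lie_algebra br sq : Prop := RestrictedLieAlgebra {
  restricted_lie : lie_algebra br;
  restricted_ad : forall x y, br (sq x) y = br x (br x y);
  restricted_scale : forall (a : F) x, sq (a *: x) = a ^+ 2 *: sq x;
  restricted_add : forall x y, sq (x + y) = sq x + sq y + br x y
}.

Record lie_derivation br D : Prop := LieDerivation {
  derivation_linear : linear D;
  derivation_leibniz : forall x y, D (br x y) = br (D x) y + br x (D y)
}.

Record restricted_derivation br sq D : Prop := RestrictedDerivation {
  restricted_derivation_lie : lie_derivation br D;
  restricted_derivation_sq : forall x, D (sq x) = br x (D x)
}.

Record ResLieDer br sq D : Prop := IsResLieDer {
  ResLieDer_lie : restricted_lie_algebra br sq;
  ResLieDer_der : restricted_derivation br sq D
}.

End LieAlgebras.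

Section Representations.
Variables (F : fieldType) (g V : lmodType F).
Implicit Types (br : g -> g -> g) (sq D : g -> g).
Implicit Types (rho : g -> V -> V) (eta : V -> V).

(* A Lie algebra morphism g -> gl(V), gl(V) being the linear endomorphisms of V
   under the commutator bracket. *)
Record lie_representation br rho : Prop := LieRepresentation {
  rep_endo : forall x, linear (rho x);
  rep_linear : forall (a : F) x y v,
    rho (a *: x + y) v = a *: rho x v + rho y v;
  rep_bracket : forall x y v,
    rho (br x y) v = rho x (rho y v) - rho y (rho x v)
}.

Record restricted_representation br sq D rho eta : Prop :=
  RestrictedRepresentation {
  restricted_rep_lie : lie_representation br rho;
  restricted_rep_eta : linear eta;
  restricted_rep_sq : forall x v, rho (sq x) v = rho x (rho x v);
  restricted_rep_der : forall x v,
    eta (rho x v) = rho (D x) v + rho x (eta v)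
}.

(* The direct sum g (+) V is the product g * V, with x + u encoded as (x, u). *)
Definition semidirect_bracket br rho (p q : g * V) : g * V :=
  (br p.1 q.1, rho p.1 q.2 - rho q.1 p.2).

Definition semidirect_sq sq rho (p : g * V) : g * V :=
  (sq p.1, rho p.1 p.2).

Definition semidirect_der D eta (p : g * V) : g * V := (D p.1, eta p.2).

End Representations.

(* Main.v *)
Require Import Defs.
From mathcomp Require Import all_boot all_order all_algebra.
Local Open Scope ring_scope.

Import GRing.Theory.

(** In each axiom the [g]-component is the corresponding axiom of [g], so only
    the [V]-component has to be computed. The Lie algebra axioms and the Leibniz
    rule hold in every characteristic: Jacobi because [rho] turns brackets into
    commutators, Leibniz because [eta (rho x v) = rho (D x) v + rho x (eta v)].
    The axioms on the 2-mapping produce on [V] the right terms up to signs and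
    up to a repeated term [rho x (rho y u)]; these discrepancies vanish since
    [- v = v] in characteristic 2. *)

Lemma oppv_pchar2 (F : fieldType) (char2 : 2%N \in [pchar F])
  (V : lmodType F) (v : V) : - v = v.
Proof. by rewrite -scaleN1r oppr_pchar2 // scale1r. Qed.

Section SemidirectProduct.
Variables (F : fieldType) (g V : lmodType F).
Variables (br : g -> g -> g) (rho : g -> V -> V).
Hypothesis rho_rep : lie_representation br rho.

Let rhoZr x (a : F) v : rho x (a *: v) = a *: rho x v.
Proof. exact: (scalable_linear (rep_endo rho_rep x)). Qed.

Let rhoBr x u v : rho x (u - v) = rho x u - rho x v.
Proof. exact: (zmod_morphism_linear (rep_endo rho_rep x)). Qed.

Let rhoDr x u v : rho x (u + v) = rho x u + rho x v.
Proof. by have := rep_endo rho_rep x 1 u v; rewrite !scale1r. Qed.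

Let rhoDl x y v : rho (x + y) v = rho x v + rho y v.
Proof. by have := rep_linear rho_rep 1 x y v; rewrite !scale1r. Qed.

Let rhoZl (a : F) x v : rho (a *: x) v = a *: rho x v.
Proof.
have rho_lin : linear (rho^~ v) by move=> b y z; exact: (rep_linear rho_rep).
exact: (scalable_linear rho_lin).
Qed.

Lemma semidirect_lie_algebra :
  lie_algebra br -> lie_algebra (semidirect_bracket br rho).
Proof.
move=> lie_br; split.
- move=> [y w] a [x u] [z v]; congr pair => /=.
    exact: (lie_linearl lie_br).
  by rewrite rhoDl rhoZl rhoDr rhoZr scalerBr opprD addrACA.
- move=> [x u] a [y v] [z w]; congr pair => /=.
    exact: (lie_linearr lie_br).
  by rewrite rhoDl rhoZl rhoDr rhoZr scalerBr opprD addrACA.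
- by move=> [x u]; congr pair; rewrite /= ?subrr ?(lie_alternating lie_br).
move=> [x u] [y v] [z w]; congr pair => /=; first exact: (lie_jacobi lie_br).
have regroup (a b c d : V) : a - b - (c - d) = (a + d) - (b + c).
  by rewrite opprB addrACA opprD.
rewrite !(rep_bracket rho_rep) !rhoBr !regroup.
(* Regrouped, the cyclic sum telescopes: (p - q) + (q - r) + (r - p). *)
rewrite [rho y (rho z u) + _]addrC subrKA.
by rewrite [rho z (rho x v) + _]addrC [rho z (rho y u) + _]addrC subrKA subrr.
Qed.

Lemma semidirect_restricted_lie_algebra (sq : g -> g) :
    2%N \in [pchar F] -> restricted_lie_algebra br sq ->
    (forall x v, rho (sq x) v = rho x (rho x v)) ->
  restricted_lie_algebra (semidirect_bracket br rho) (semidirect_sq sq rho).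
Proof.
move=> char2 res_br rho_sq; split.
- exact: semidirect_lie_algebra (restricted_lie res_br).
- move=> [x u] [y v]; congr pair => /=; first exact: (restricted_ad res_br).
  rewrite rho_sq (rep_bracket rho_rep) rhoBr -addrA; congr (_ + _).
  (* The repeated term [rho x (rho y u)] cancels against itself. *)
  rewrite !(oppv_pchar2 F char2) addrA -{1}[rho x (rho y u)](oppv_pchar2 F char2).
  by rewrite addNr add0r.
- move=> a [x u]; congr pair => /=; first exact: (restricted_scale res_br).
  by rewrite rhoZl rhoZr scalerA expr2.
move=> [x u] [y v]; congr pair => /=; first exact: (restricted_add res_br).
rewrite rhoDl !rhoDr (oppv_pchar2 F char2).
by rewrite [rho y u + _]addrC addrACA.
Qed.

Lemma semidirect_lie_derivation (D : g -> g) (eta : V -> V) :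
    lie_derivation br D -> linear eta ->
    (forall x v, eta (rho x v) = rho (D x) v + rho x (eta v)) ->
  @lie_derivation F (g * V)%type (semidirect_bracket br rho)
    (semidirect_der D eta).
Proof.
move=> der_D eta_lin eta_rho; split.
  move=> a [x u] [y v]; congr pair => /=; last exact: eta_lin.
  exact: (derivation_linear der_D).
move=> [x u] [y v]; congr pair => /=; first exact: (derivation_leibniz der_D).
rewrite (zmod_morphism_linear eta_lin) !eta_rho.
by rewrite [rho (D y) u + _]addrC opprD addrACA.
Qed.

End SemidirectProduct.

Theorem proposition2p14 (F : fieldType) (char2 : 2%N \in [pchar F])
  (g : lmodType F) (br : g -> g -> g) (sq D : g -> g)
  (hg : ResLieDer br sq D)
  (V : lmodType F) (rho : g -> V -> V) (eta : V -> V)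
  (hV : restricted_representation br sq D rho eta) :
  @ResLieDer F (g * V)%type (semidirect_bracket br rho)
    (semidirect_sq sq rho) (semidirect_der D eta).
Proof.
case: hg => res_br [der_D D_sq]; case: hV => rho_rep eta_lin rho_sq eta_rho.
split; first exact: semidirect_restricted_lie_algebra.
split; first exact: semidirect_lie_derivation.
move=> [x u]; congr pair => /=; first exact: D_sq.
by rewrite eta_rho addrC (oppv_pchar2 F char2).
Qed.
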